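(* Let $\lambda,\eta,r\in\mathbb{R}^+$, let $b,c\in\mathbb{C}$ with $\Re(c)>\Re(b)>0$, and let $p,q\in\mathbb{C}$ with $\min\{\Re(p),\Re(q)\}\ge 0$. Let $\boldsymbol a=(a_n)_{n\ge1}$ be a sequence of positive real numbers which increases monotonically and tends to $\infty$. Let $a:\mathbb{R}^+\to\mathbb{R}^+$ be an increasing function with $a(n)=a_n$ for all $n\in\mathbb{N}$ and with inverse $a^{-1}$ defined on $[a_1,\infty)$, and let $[a^{-1}(x)]$ denote the integer part of $a^{-1}(x)$. For $\lambda,\eta>0$ put $$\mathscr I_{p,q}(\lambda,\eta)=\int_{a_1}^\infty \frac{F_{p,q}\left(\lambda,b;c;-\frac{r^2}{x}\right)\,[a^{-1}(x)]}{x^\lambda(x+r^2)^\eta}\,\mathrm{d}x,$$ $$\widetilde{\mathscr I}_{p,q}(\lambda,\eta)=\int_{a_1}^\infty \frac{F_{p,q}\left(\lambda,b;c;-\frac{r^2}{x}\right)\,\sin^2\left(\frac{\pi}{2}[a^{-1}(x)]\right)}{x^\lambda(x+r^2)^\eta}\,\mathrm{d}x .$$ Then, with all series and integrals involved assumed convergent, $$\mathfrak F_{\lambda,\eta}(F_{p,q};\boldsymbol a;r)=\lambda\,\mathscr I_{p,q}(\lambda+1,\eta)+\eta\,\mathscr I_{p,q}(\lambda,\eta+1)$$ and $$\widetilde{\mathfrak F}_{\lambda,\eta}(F_{p,q};\boldsymbol a;r)=\lambda\,\widetilde{\mathscr I}_{p,q}(\lambda+1,\eta)+\eta\,\widetilde{\mathscr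 I}_{p,q}(\lambda,\eta+1).$$
   Context: $\mathbb{R}^+$ is the set of positive reals. $\mathrm{B}(x,y)$ is Euler's Beta function and $(\alpha)_n$ is the Pochhammer symbol. The $(p,q)$-extended Beta function is $$\mathrm{B}(x,y;p,q)=\int_0^1 t^{x-1}(1-t)^{y-1}e^{-\frac{p}{t}-\frac{q}{1-t}}\,\mathrm{d}t\qquad(\min\{\Re(p),\Re(q)\}\ge0),$$ with $\min\{\Re(x),\Re(y)\}>0$ if $p=q=0$. For $\Re(c)>\Re(b)>0$, the $(p,q)$-extended Gauss hypergeometric function is $$F_{p,q}(\alpha,b;c;z)=\sum_{n\ge0}(\alpha)_n\frac{\mathrm{B}(b+n,c-b;p,q)}{\mathrm{B}(b,c-b)}\frac{z^n}{n!}\qquad(|z|<1).$$ For real $z\le -1$ the value is understood through the integral representation (which agrees with the series for $|z|<1$) $$F_{p,q}(\alpha,b;c;z)=\frac{1}{\mathrm{B}(b,c-b)}\int_0^1\frac{t^{b-1}(1-t)^{c-b-1}}{(1-zt)^\alpha}\exp\left(-\frac pt-\frac q{1-t}\right)\mathrm{d}t .$$ The Mathieu-type series and its alternating variant are $$\mathfrak F_{\lambda,\eta}(F_{p,q};\boldsymbol a;r)=\sum_{n\ge1}\frac{F_{p,q}\left(\lambda,b;c;-\frac{r^2}{a_n}\right)}{a_n^\lambda(a_n+r^2)^\eta},\qquad \widetilde{\mathfrak F}_{\lambda,\eta}(F_{p,q};\boldsymbol a;r)=\sum_{n\ge1}\frac{(-1)^{n-1}F_{p,q}\left(\lambda,b;c;-\frac{r^2}{a_n}\right)}{a_n^\lambda(a_n+r^2)^\eta}.$$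 *)

(* Defs.v *)
From Stdlib Require Import Reals Factorial.
From Coquelicot Require Import Coquelicot.

Open Scope R_scope.

(** Complex-valued integrals are improper Riemann integrals over the real normed
    module [C_R_CompleteNormedModule], and convergence of complex series is taken in
    the same module.  [RInt_gen] and [CSeries] are total and are meaningful only
    when the integral or series converges. *)

Definition Cexp (z : C) : C := (exp (Re z) * cos (Im z), exp (Re z) * sin (Im z)).

(** Principal power t^s of a base t > 0; meaningless for t <= 0. *)
Definition cpow (t : R) (s : C) : C := Cexp (s * RtoC (ln t))%C.

Fixpoint pochhammer (alpha : C) (n : nat) : C :=
  match n with
  | O => RtoC 1
  | S m => (pochhammer alpha m * (alpha + RtoC (INR m)))%C
  end.

Definition CSeries (u : nat -> C) : C :=
  iota (fun l : C_R_CompleteNormedModule =>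
    is_series (V := C_R_NormedModule) u l).

(** Improper at both ends: t -> 0+ and t -> 1- independently. *)
Definition CInt01 (f : R -> C) : C :=
  RInt_gen (V := C_R_CompleteNormedModule) f (at_right 0) (at_left 1).

Definition ex_CInt_infty (f : R -> C) (x0 : R) : Prop :=
  ex_RInt_gen (V := C_R_NormedModule) f (at_point x0) (Rbar_locally p_infty).

Definition CInt_infty (f : R -> C) (x0 : R) : C :=
  RInt_gen (V := C_R_CompleteNormedModule) f (at_point x0) (Rbar_locally p_infty).

Definition pq_weight (p q : C) (t : R) : C :=
  Cexp (- (p / RtoC t) - q / RtoC (1 - t))%C.

Definition Beta (x y : C) : C :=
  CInt01 (fun t => cpow t (x - 1) * cpow (1 - t) (y - 1))%C.

Definition Beta_pq (x y p q : C) : C :=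
  CInt01 (fun t => cpow t (x - 1) * cpow (1 - t) (y - 1) * pq_weight p q t)%C.

Definition F_series (p q alpha b c z : C) : C :=
  CSeries (fun n =>
    pochhammer alpha n * (Beta_pq (b + RtoC (INR n)) (c - b) p q / Beta b (c - b))
      * (z ^ n / RtoC (INR (fact n))))%C.

Definition F_integral (p q alpha b c : C) (z : R) : C :=
  (/ Beta b (c - b) *
   CInt01 (fun t =>
     cpow t (b - 1) * cpow (1 - t) (c - b - 1) / cpow (1 - z * t) alpha
       * pq_weight p q t))%C.

(** F_{p,q}(alpha, b; c; z) at a real argument z < 1: the power series for
    -1 < z < 1 and the integral representation for z <= -1. *)
Definition F_pq (p q alpha b c : C) (z : R) : C :=
  if Rle_dec z (-1) then F_integral p q alpha b c z
  else F_series p q alpha b c (RtoC z).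

Definition mathieu_kernel (p q b c : C) (r lam eta x : R) : C :=
  (F_pq p q (RtoC lam) b c (- (r ^ 2 / x))
    / RtoC (Rpower x lam * Rpower (x + r ^ 2) eta))%C.

(** Coquelicot series start at 0, so index n below stands for n + 1; in
    particular (-1)^(n-1) becomes (-1)^n. *)
Definition mathieu_term (p q b c : C) (a_ : nat -> R) (r lam eta : R) (n : nat) : C :=
  mathieu_kernel p q b c r lam eta (a_ (S n)).

Definition alt_mathieu_term (p q b c : C) (a_ : nat -> R) (r lam eta : R) (n : nat) : C :=
  (RtoC ((-1) ^ n) * mathieu_term p q b c a_ r lam eta n)%C.

Definition mathieu_series (p q b c : C) (a_ : nat -> R) (r lam eta : R) : C :=
  CSeries (mathieu_term p q b c a_ r lam eta).

Definition alt_mathieu_series (p q b c : C) (a_ : nat -> R) (r lam eta : R) : C :=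
  CSeries (alt_mathieu_term p q b c a_ r lam eta).

Definition I_integrand (p q b c : C) (ainv : R -> R) (r lam eta x : R) : C :=
  (mathieu_kernel p q b c r lam eta x * RtoC (IZR (Int_part (ainv x))))%C.

Definition alt_I_integrand (p q b c : C) (ainv : R -> R) (r lam eta x : R) : C :=
  (mathieu_kernel p q b c r lam eta x
    * RtoC (sin (PI / 2 * IZR (Int_part (ainv x))) ^ 2))%C.

(* Main.v *)
Require Import Defs.
From Stdlib Require Import Reals Factorial Lra Lia.
From Coquelicot Require Import Coquelicot.

(** Write [K lam eta x] for the kernel
    [F_pq lam b c (- r ^ 2 / x) / (x ^ lam * (x + r ^ 2) ^ eta)], so that the series is the sum
    of [K lam eta (a_ n)]. By the integral representation of [F_pq], up to the constant
    [/ Beta b (c - b)], [K lam eta x] is the integral over (0,1) of a fixed complex weight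
    against the real function
    [t |-> (x + r ^ 2 * t) ^ (- lam) * (x + r ^ 2) ^ (- eta)].
    Differentiation in [x] under the integral sign gives

    [(K lam eta)' = - lam * K (lam + 1) eta - eta * K lam (eta + 1)],

    so that the combined integrand on the right-hand side is minus this derivative times a
    function of the integer part of [ainv x] ([is_derive_mathieu_kernel]). Since [ainv x] has
    integer part [n] for [a_ n < x < a_ (n + 1)], integrating piecewise from [a_ 1] to
    [a_ (N + 1)] turns the integral into the finite sum of
    [w n * (K (a_ n) - K (a_ (n + 1)))], with [w n = n] or [w n = sin (pi n / 2) ^ 2]
    ([mathieu_abel_limit]).

    For the squared sine, this sum telescopes in pairs to a partial sum of the alternating
    series ([abel_limit_alternating]). For [w n = n] it is a partial sum of the series minus
    [N * K (a_ (N + 1))]. The boundary term has a limit since the series and the integrals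
    converge, and that limit is 0: otherwise [K (a_ n)] would be comparable to [1 / n] and
    the series would diverge ([abel_limit_index]).

    The integral representation must be linked to the series that defines [F_pq] when
    [x > r ^ 2] ([F_pq_weighted_integral]). This and the differentiation rest on a single
    estimate: the weight is dominated by a Beta density, so the weighted integral is bounded
    by a constant times the supremum of the integrated function
    ([weighted_integral_bound]). It is applied to Taylor remainders, of the binomial series in
    the first case and of first order in [x] in the second, that are small uniformly
    in [t]. *)

(** * Complex exponentials, powers and continuity *)

Lemma C_eq (z w : C) : Re z = Re w -> Im z = Im w -> z = w.
Proof. destruct z, w; simpl; intros -> ->; reflexivity. Qed.

(** Ring goals whose sums were built by the module operations on [C]. *)
Ltac Cring :=
  repeat match goal with
    |- context [@plus ?G ?x ?y] => change (@plus G x y) with (Cplus x y)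
  end;
  match goal with |- @eq _ ?x ?y => change (@eq C x y) end; ring.

Lemma Cexp_plus (z w : C) : Cexp (z + w)%C = (Cexp z * Cexp w)%C.
Proof.
  destruct z as [x y], w as [u v]; unfold Cexp; apply C_eq; simpl;
    rewrite exp_plus, ?cos_plus, ?sin_plus; ring.
Qed.

Lemma Cexp_RtoC (x : R) : Cexp (RtoC x) = RtoC (exp x).
Proof. unfold Cexp; apply C_eq; simpl; rewrite ?cos_0, ?sin_0; ring. Qed.

Lemma Cmod_Cexp (z : C) : Cmod (Cexp z) = exp (Re z).
Proof.
  destruct z as [x y]; unfold Cmod, Cexp; simpl.
  replace (_ + _) with (exp x * exp x).
  - apply sqrt_square, Rlt_le, exp_pos.
  - generalize (sin2_cos2 y); unfold Rsqr; intro H.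
    transitivity (exp x * exp x * (sin y * sin y + cos y * cos y)); [rewrite H|]; ring.
Qed.

Lemma cpow_plus (t : R) (s u : C) : cpow t (s + u) = (cpow t s * cpow t u)%C.
Proof. unfold cpow; rewrite Cmult_plus_distr_r; apply Cexp_plus. Qed.

Lemma cpow_RtoC (t s : R) : cpow t (RtoC s) = RtoC (Rpower t s).
Proof. unfold cpow, Rpower; rewrite <- RtoC_mult; apply Cexp_RtoC. Qed.

Lemma Cmod_cpow (t : R) (s : C) : Cmod (cpow t s) = Rpower t (Re s).
Proof.
  unfold cpow, Rpower; rewrite Cmod_Cexp; f_equal.
  destruct s; simpl; ring.
Qed.

Lemma continuous_C (f : R -> C) (x : R) :
  continuous (fun t => Re (f t)) x -> continuous (fun t => Im (f t)) x ->
  continuous (U := C_R_NormedModule) f x.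
Proof.
  intros H1 H2; apply filterlim_locally; intro eps.
  generalize (proj1 (filterlim_locally _ _) H1 eps) (proj1 (filterlim_locally _ _) H2 eps).
  intros A B; generalize (filter_and _ _ A B); apply filter_imp; intros y [U V]; split; assumption.
Qed.

Lemma filterlim_Re {T : Type} (F : (T -> Prop) -> Prop) {FF : Filter F} (f : T -> C) (l : C) :
  filterlim f F (locally (T := C_R_NormedModule) l) ->
  filterlim (fun t => Re (f t)) F (locally (Re l)).
Proof.
  intro H; apply filterlim_locally; intro eps.
  generalize (proj1 (filterlim_locally _ _) H eps); apply filter_imp; intros y [U _]; exact U.
Qed.

Lemma filterlim_Im {T : Type} (F : (T -> Prop) -> Prop) {FF : Filter F} (f : T -> C) (l : C) :
  filterlim f F (locally (T := C_R_NormedModule) l) ->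
  filterlim (fun t => Im (f t)) F (locally (Im l)).
Proof.
  intro H; apply filterlim_locally; intro eps.
  generalize (proj1 (filterlim_locally _ _) H eps); apply filter_imp; intros y [_ U]; exact U.
Qed.

Lemma continuous_Cmult (f g : R -> C) (x : R) :
  continuous (U := C_R_NormedModule) f x -> continuous (U := C_R_NormedModule) g x ->
  continuous (U := C_R_NormedModule) (fun t => Cmult (f t) (g t)) x.
Proof.
  intros Hf Hg.
  generalize (filterlim_Re _ _ _ Hf) (filterlim_Im _ _ _ Hf)
             (filterlim_Re _ _ _ Hg) (filterlim_Im _ _ _ Hg); intros A B D E.
  apply continuous_C; simpl.
  - apply (continuous_minus (V := R_NormedModule));
      apply (continuous_mult (K := R_AbsRing)); assumption.
  - apply (continuous_plus (V := R_NormedModule));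
      apply (continuous_mult (K := R_AbsRing)); assumption.
Qed.

Lemma continuous_Cexp (f : R -> C) (x : R) :
  continuous (U := C_R_NormedModule) f x ->
  continuous (U := C_R_NormedModule) (fun t => Cexp (f t)) x.
Proof.
  intro Hf; generalize (filterlim_Re _ _ _ Hf) (filterlim_Im _ _ _ Hf); intros A B.
  apply continuous_C; simpl; apply (continuous_mult (K := R_AbsRing)).
  1,3: apply (continuous_comp (fun t => Re (f t)) exp); [assumption|];
    apply continuous_exp.
  - apply (continuous_comp (fun t => Im (f t)) cos); [assumption|apply continuous_cos].
  - apply (continuous_comp (fun t => Im (f t)) sin); [assumption|apply continuous_sin].
Qed.

Lemma continuous_RtoC (f : R -> R) (x : R) :
  continuous f x -> continuous (U := C_R_NormedModule) (fun t => RtoC (f t)) x.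
Proof.
  intro H; apply continuous_C; simpl; [exact H|apply continuous_const].
Qed.

(** * Absolutely convergent improper integrals *)

Lemma minus_plus_middle {G : AbelianGroup} (x y z : G) :
  minus (plus (plus x y) z) y = plus x z.
Proof.
  unfold minus; rewrite (plus_comm x y), <- (plus_assoc y x z), (plus_comm y (plus x z)).
  rewrite <- (plus_assoc (plus x z)), (plus_opp_r y); apply plus_zero_r.
Qed.

(** The two endpoints come in either order, because the Cauchy criterion below compares
    arbitrary pairs of endpoints near the singular ones. *)
Lemma norm_RInt_le_primitive {V : NormedModule R_AbsRing} (f : R -> V) (H h : R -> R)
  (a b x y : R) (l : V) :
  (forall t, a < t < b -> is_derive H t (h t)) ->
  (forall t, a < t < b -> continuous h t) ->
  (forall t, a < t < b -> norm (f t) <= h t) ->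
  a < x < b -> a < y < b -> is_RInt f x y l -> norm l <= Rabs (H y - H x).
Proof.
  intros H1 H2 H3.
  assert (Hord : forall x y l, a < x < b -> a < y < b -> x <= y ->
            is_RInt f x y l -> norm l <= Rabs (H y - H x)).
  { clear x y l; intros x y l Hx Hy Hxy HI.
    apply Rle_trans with (2 := Rle_abs _).
    apply (norm_RInt_le f h x y l); trivial.
    - intros t Ht; apply H3; lra.
    - apply (is_RInt_derive (V := R_CompleteNormedModule) H h);
        intros t; rewrite Rmin_left, Rmax_right by lra; intro Ht.
      + apply H1; lra.
      + apply H2; lra. }
  intros Hx Hy HI; destruct (Rle_dec x y) as [L|L].
  - apply Hord; assumption.
  - rewrite Rabs_minus_sym, <- (norm_opp l); apply Hord; trivial; [lra|].
    apply is_RInt_swap, HI.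
Qed.

(** Comparison test at two singular endpoints. The primitive [H] of the majorant has
    limits there, so its increments near each endpoint are small; they control the
    increments of the integral of [f], and the Cauchy criterion applies. *)
Lemma is_RInt_gen_dominated {V : CompleteNormedModule R_AbsRing} (f : R -> V)
  (H h : R -> R) (a b la lb : R) :
  a < b ->
  (forall t, a < t < b -> continuous f t) ->
  (forall t, a < t < b -> is_derive H t (h t)) ->
  (forall t, a < t < b -> continuous h t) ->
  (forall t, a < t < b -> norm (f t) <= h t) ->
  filterlim H (at_right a) (locally la) -> filterlim H (at_left b) (locally lb) ->
  exists l : V, is_RInt_gen f (at_right a) (at_left b) l /\ norm l <= lb - la.
Proof.
  intros Hab Hf H1 H2 H3 Hla Hlb.
  set (m := (a + b) / 2).
  assert (Hr : at_right a (fun x => a < x < m)).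
  { assert (Hm : 0 < m - a) by (unfold m; lra).
    exists (mkposreal _ Hm); intros y By Hy; split; trivial.
    apply Rabs_lt_between' in By; simpl in By; lra. }
  assert (Hl : at_left b (fun x => m < x < b)).
  { assert (Hm : 0 < b - m) by (unfold m; lra).
    exists (mkposreal _ Hm); intros y By Hy; split; trivial.
    apply Rabs_lt_between' in By; simpl in By; lra. }
  assert (Hrl : forall P : R * R -> Prop,
            (forall x y, a < x < m -> m < y < b -> P (x, y)) ->
            filter_prod (at_right a) (at_left b) P).
  { intros P HP; apply (Filter_prod _ _ _ _ _ Hr Hl HP). }
  assert (Hex : forall x y, a < x < b -> a < y < b -> ex_RInt f x y).
  { intros x y Hx Hy; apply ex_RInt_continuous; intros z Hz; apply Hf.
    split; [apply Rlt_le_trans with (2 := proj1 Hz); apply Rmin_glb_lt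
           |apply Rle_lt_trans with (1 := proj2 Hz); apply Rmax_lub_lt]; lra. }
  assert (Hgen : exists l : V, is_RInt_gen f (at_right a) (at_left b) l).
  { apply (filterlimi_locally_cauchy (U := V)
             (fun ab : R * R => is_RInt f (fst ab) (snd ab))).
    - apply Hrl; simpl; intros x y Hx Hy; split.
      + apply Hex; unfold m in *; lra.
      + intros y1 y2 I1 I2; rewrite <- (is_RInt_unique _ _ _ _ I1); apply is_RInt_unique, I2.
    - intro eps.
      assert (He : 0 < eps / 4) by (generalize (cond_pos eps); lra).
      generalize (proj1 (filterlim_locally _ _) Hla (mkposreal _ He))
        (proj1 (filterlim_locally _ _) Hlb (mkposreal _ He)); intros A B.
      generalize (filter_and _ _ A Hr) (filter_and _ _ B Hl); clear A B; intros A B.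
      exists (fun u => (ball la (eps / 4) (H (fst u)) /\ a < fst u < m) /\
                       (ball lb (eps / 4) (H (snd u)) /\ m < snd u < b)).
      split.
      { apply (Filter_prod _ _ _ _ _ A B); intros x y Hx Hy; split; assumption. }
      intros [u1 u2] [v1 v2] [[Bu1 Iu1] [Bu2 Iu2]] [[Bv1 Iv1] [Bv2 Iv2]] u' v'; simpl in *.
      intros Hu Hv.
      assert (Hm : a < m < b) by (unfold m; lra).
      destruct (Hex u1 v1) as [d1 Hd1]; try lra.
      destruct (Hex v2 u2) as [d2 Hd2]; try lra.
      (* The integrals over [u1, u2] and [v1, v2] differ only by two end pieces. *)
      assert (E : u' = plus (plus d1 v') d2).
      { rewrite <- (is_RInt_unique _ _ _ _ Hu); apply is_RInt_unique.
        apply is_RInt_Chasles with v2; trivial; apply is_RInt_Chasles with v1; trivial. }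
      apply ball_sym, (norm_compat1 (V := CompleteNormedModule.NormedModule _ V)).
      apply Rle_lt_trans with (norm (plus d1 d2)).
      { right; apply f_equal; rewrite E.
        apply (minus_plus_middle (G := CompleteNormedModule.AbelianGroup _ V)). }
      apply Rle_lt_trans with (1 := norm_triangle _ _).
      generalize (norm_RInt_le_primitive f H h a b u1 v1 d1 H1 H2 H3) 
        (norm_RInt_le_primitive f H h a b v2 u2 d2 H1 H2 H3); intros N1 N2.
      assert (N1' := N1 ltac:(lra) ltac:(lra) Hd1).
      assert (N2' := N2 ltac:(lra) ltac:(lra) Hd2).
      apply Rabs_lt_between' in Bu1, Bv1, Bu2, Bv2; simpl in *.
      assert (Rabs (H v1 - H u1) < eps / 2) by (apply Rabs_def1; lra).
      assert (Rabs (H u2 - H v2) < eps / 2) by (apply Rabs_def1; lra).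
      apply Rle_lt_trans with (Rabs (H v1 - H u1) + Rabs (H u2 - H v2)).
      { exact (Rplus_le_compat _ _ _ _ N1' N2'). }
      lra. }
  destruct Hgen as [l Hgl]; exists l; split; trivial.
  apply (RInt_gen_norm (Fa := at_right a) (Fb := at_left b) f h l (lb - la)).
  - apply Hrl; simpl; intros; lra.
  - apply Hrl; simpl; intros; apply H3; lra.
  - exact Hgl.
  - apply (is_RInt_gen_ext (Derive H)).
    + apply Hrl; simpl; intros x y Hx Hy t; rewrite Rmin_left, Rmax_right by lra; intro Ht.
      apply is_derive_unique, H1; lra.
    + apply is_RInt_gen_Derive; trivial; apply Hrl; simpl; intros x y Hx Hy t;
        rewrite Rmin_left, Rmax_right by lra; intro Ht.
      * exists (h t); apply H1; lra.
      * apply (continuous_ext_loc _ h); [|apply H2; lra].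
        assert (Hd : 0 < Rmin (t - a) (b - t)) by (apply Rmin_glb_lt; lra).
        exists (mkposreal _ Hd); intros z Bz; symmetry; apply is_derive_unique, H1.
        apply Rabs_lt_between' in Bz; simpl in Bz.
        generalize (Rmin_l (t - a) (b - t)) (Rmin_r (t - a) (b - t)); lra.
Qed.

(** * Domination by Beta densities *)

Lemma is_derive_Rpower (x y : R) :
  0 < x -> is_derive (fun t => Rpower t y) x (y * Rpower x (y - 1)).
Proof. intro Hx; apply is_derive_Reals, derivable_pt_lim_power, Hx. Qed.

Lemma continuous_Rpower (x y : R) : 0 < x -> continuous (fun t => Rpower t y) x.
Proof.
  intro Hx; apply (ex_derive_continuous (V := R_NormedModule)).
  eexists; apply is_derive_Rpower, Hx.
Qed.

Lemma Rpower_1_l (y : R) : Rpower 1 y = 1.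
Proof. unfold Rpower; rewrite ln_1, Rmult_0_r, exp_0; reflexivity. Qed.

Lemma Rpower_le_1 (x y : R) : 0 < x <= 1 -> 0 <= y -> Rpower x y <= 1.
Proof.
  intros [H0 H1] Hy; rewrite <- (Rpower_1_l y).
  apply Rle_Rpower_l; lra.
Qed.

Lemma filterlim_Rpower_0 (y : R) :
  0 < y -> filterlim (fun t => Rpower t y) (at_right 0) (locally 0).
Proof.
  intro Hy; unfold Rpower.
  apply (filterlim_comp _ _ _ (fun t => y * ln t) exp _ (Rbar_locally m_infty)).
  - apply (filterlim_comp _ _ _ ln (fun u => y * u) _ (Rbar_locally m_infty)).
    + exact is_lim_ln_0.
    + generalize (filterlim_Rbar_mult_l y m_infty); simpl.
      destruct (Rle_dec 0 y) as [Hy'|]; [|lra].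
      destruct (Rle_lt_or_eq_dec 0 y Hy'); [|lra].
      intro L; exact L.
  - exact is_lim_exp_m.
Qed.

Lemma filterlim_lincomb {T : Type} (F : (T -> Prop) -> Prop) {FF : Filter F}
  (f g : T -> R) (x y c d : R) :
  filterlim f F (locally x) -> filterlim g F (locally y) ->
  filterlim (fun t => c * f t + d * g t) F (locally (c * x + d * y)).
Proof.
  intros Hf Hg.
  apply (filterlim_comp_2 (fun t => c * f t) (fun t => d * g t) Rplus
           (G := locally (c * x)) (H := locally (d * y))).
  - apply (filterlim_comp _ _ _ f (Rmult c) _ (locally x)); trivial.
    exact (filterlim_scal_r (V := R_NormedModule) c x).
  - apply (filterlim_comp _ _ _ g (Rmult d) _ (locally y)); trivial.
    exact (filterlim_scal_r (V := R_NormedModule) d y).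
  - exact (filterlim_plus (V := R_NormedModule) (c * x) (d * y)).
Qed.

Lemma filterlim_one_minus_at_left : filterlim (fun t => 1 - t) (at_left 1) (at_right 0).
Proof.
  intros P [d Hd]; exists d; intros y By Hy; apply Hd; [|lra].
  apply Rabs_lt_between' in By; apply Rabs_lt_between'; simpl; lra.
Qed.

Lemma Rpower_pred (x y : R) : 0 < x -> Rpower x (y - 1) = Rpower x y / x.
Proof.
  intro Hx; unfold Rminus, Rdiv; rewrite Rpower_plus, Rpower_Ropp, Rpower_1; trivial.
Qed.

(** At each point of (0,1) one of [t] and [1 - t] is at least 1/2, and the corresponding
    factor is then at most 2. The sum on the right has an explicit primitive, whereas the
    product on the left does not. *)
Lemma beta_density_le (beta gamma t : R) :
  0 < beta -> 0 < gamma -> 0 < t < 1 ->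
  Rpower t (beta - 1) * Rpower (1 - t) (gamma - 1) <=
    2 * (Rpower t (beta - 1) + Rpower (1 - t) (gamma - 1)).
Proof.
  intros Hb Hg Ht.
  assert (P1 : 0 < Rpower t (beta - 1)) by apply exp_pos.
  assert (P2 : 0 < Rpower (1 - t) (gamma - 1)) by apply exp_pos.
  assert (half : forall x y, 0 < y -> / 2 <= x <= 1 -> Rpower x (y - 1) <= 2).
  { intros x y Hy Hx; rewrite Rpower_pred by lra.
    replace 2 with (1 * / / 2) by field; apply Rmult_le_compat.
    - apply Rlt_le, exp_pos.
    - apply Rlt_le, Rinv_0_lt_compat; lra.
    - apply Rpower_le_1; lra.
    - apply Rinv_le_contravar; lra. }
  destruct (Rle_dec t (/ 2)) as [L|L].
  - assert (Rpower (1 - t) (gamma - 1) <= 2) by (apply half; lra); nra.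
  - assert (Rpower t (beta - 1) <= 2) by (apply half; lra); nra.
Qed.

(** Absolute convergence and norm estimate at once for everything bounded by a multiple of
    a Beta density. The constant [2 * (/ beta + / gamma)] is the exact integral of the
    majorant from [beta_density_le]. *)
Lemma is_RInt_gen_beta_dominated (f : R -> C) (beta gamma M : R) :
  0 < beta -> 0 < gamma ->
  (forall t, 0 < t < 1 -> continuous (U := C_R_NormedModule) f t) ->
  (forall t, 0 < t < 1 ->
     Cmod (f t) <= M * (Rpower t (beta - 1) * Rpower (1 - t) (gamma - 1))) ->
  is_RInt_gen (V := C_R_NormedModule) f (at_right 0) (at_left 1) (CInt01 f) /\
  Cmod (CInt01 f) <= M * (2 * (/ beta + / gamma)).
Proof.
  intros Hb Hg Hf HM.
  assert (M0 : 0 <= M).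
  { assert (Ht : 0 < / 2 < 1) by lra.
    assert (P : 0 < Rpower (/ 2) (beta - 1) * Rpower (1 - / 2) (gamma - 1))
      by (apply Rmult_lt_0_compat; apply exp_pos).
    generalize (HM _ Ht) (Cmod_ge_0 (f (/ 2))); intros A B.
    apply Rnot_lt_le; intro N; nra. }
  assert (R1 : filterlim (fun t => Rpower (1 - t) gamma) (at_right 0) (locally 1)).
  { assert (C1 : continuous (fun t => Rpower (1 - t) gamma) 0).
    { apply (ex_derive_continuous (V := R_NormedModule)); unfold Rpower; auto_derive; lra. }
    unfold continuous in C1; rewrite Rminus_0_r, Rpower_1_l in C1.
    apply filterlim_filter_le_1 with (2 := C1), filter_le_within; apply locally_filter. }
  assert (L1 : filterlim (fun t => Rpower t beta) (at_left 1) (locally 1)).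
  { generalize (continuous_Rpower 1 beta Rlt_0_1); unfold continuous; rewrite Rpower_1_l.
    intro C1; apply filterlim_filter_le_1 with (2 := C1), filter_le_within; apply locally_filter. }
  destruct (is_RInt_gen_dominated (V := C_R_CompleteNormedModule) f
    (fun t => 2 * M / beta * Rpower t beta + - (2 * M / gamma) * Rpower (1 - t) gamma)
    (fun t => M * 2 * (Rpower t (beta - 1) + Rpower (1 - t) (gamma - 1)))
    0 1 (2 * M / beta * 0 + - (2 * M / gamma) * 1)
    (2 * M / beta * 1 + - (2 * M / gamma) * 0)) as [l [Hl Nl]].
  - lra.
  - exact Hf.
  - intros t Ht; rewrite !Rpower_pred by lra; unfold Rpower; auto_derive; [lra|].
    unfold Rminus; field; lra.
  - intros t Ht; apply (ex_derive_continuous (V := R_NormedModule)).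
    unfold Rpower; auto_derive; lra.
  - intros t Ht; rewrite <- Cmod_norm; apply Rle_trans with (1 := HM _ Ht).
    rewrite Rmult_assoc; apply Rmult_le_compat_l; trivial.
    apply beta_density_le; trivial.
  - apply (filterlim_lincomb (at_right 0)); [apply filterlim_Rpower_0, Hb|exact R1].
  - apply (filterlim_lincomb (at_left 1)); [exact L1|].
    apply (filterlim_comp _ _ _ (fun t => 1 - t) (fun t => Rpower t gamma) _ (at_right 0)).
    + exact filterlim_one_minus_at_left.
    + apply filterlim_Rpower_0, Hg.
  - unfold CInt01; rewrite (is_RInt_gen_unique (V := C_R_CompleteNormedModule) _ _ Hl).
    split; [exact Hl|].
    rewrite <- Cmod_norm in Nl; apply Rle_trans with (1 := Nl); right; field; lra.
Qed.

(** * Integration against the weight of the extended Beta function *)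

Lemma is_RInt_gen01_ext (f g : R -> C) (l : C) :
  (forall t, 0 < t < 1 -> f t = g t) ->
  is_RInt_gen (V := C_R_NormedModule) f (at_right 0) (at_left 1) l ->
  is_RInt_gen (V := C_R_NormedModule) g (at_right 0) (at_left 1) l.
Proof.
  intros E; apply is_RInt_gen_ext.
  apply (Filter_prod _ _ _ (fun x => 0 < x < 1) (fun x => 0 < x < 1)).
  - exists (mkposreal 1 Rlt_0_1); intros y By Hy.
    apply Rabs_lt_between' in By; simpl in By; lra.
  - exists (mkposreal 1 Rlt_0_1); intros y By Hy.
    apply Rabs_lt_between' in By; simpl in By; lra.
  - intros x y Hx Hy t [H1 H2]; apply E; split.
    + apply Rlt_trans with (2 := H1), Rmin_glb_lt; simpl; lra.
    + apply Rlt_trans with (1 := H2), Rmax_lub_lt; simpl; lra.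
Qed.

Lemma CInt01_unique (f : R -> C) (l : C) :
  is_RInt_gen (V := C_R_NormedModule) f (at_right 0) (at_left 1) l -> CInt01 f = l.
Proof. exact (is_RInt_gen_unique (V := C_R_CompleteNormedModule) f l). Qed.

Definition beta_weight (p q b c : C) (t : R) : C :=
  (cpow t (b - 1) * cpow (1 - t) (c - b - 1) * pq_weight p q t)%C.

(** Up to the factor [/ Beta b (c - b)], the coefficients and the integral representation
    of [F_pq], the Mathieu kernel and its derivative are values of this linear functional at
    bounded real functions [phi]; all analysis then reduces to uniform estimates on
    [phi]. *)
Definition weighted_integral (p q b c : C) (phi : R -> R) : C :=
  CInt01 (fun t => beta_weight p q b c t * RtoC (phi t))%C.

(** An upper bound for the integral of the modulus of [beta_weight], not its value. *)
Definition weighted_mass (b c : C) : R := 2 * (/ Re b + / (Re c - Re b)).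

Definition bounded_continuous01 (phi : R -> R) : Prop :=
  (forall t, 0 < t < 1 -> continuous phi t) /\
  exists M, forall t, 0 < t < 1 -> Rabs (phi t) <= M.

Lemma Cmod_pq_weight_le_1 (p q : C) (t : R) :
  0 <= Re p -> 0 <= Re q -> 0 < t < 1 -> Cmod (pq_weight p q t) <= 1.
Proof.
  intros Hp Hq Ht; unfold pq_weight; rewrite Cmod_Cexp.
  apply Rle_trans with (exp 0); [|rewrite exp_0; lra].
  assert (A : 0 <= Re p / t) by (apply Rdiv_le_0_compat; lra).
  assert (B : 0 <= Re q / (1 - t)) by (apply Rdiv_le_0_compat; lra).
  replace (Re _) with (- (Re p / t) - Re q / (1 - t)).
  - destruct (Rle_lt_or_eq_dec (- (Re p / t) - Re q / (1 - t)) 0) as [L|L]; [lra| |].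
    + apply Rlt_le, exp_increasing, L.
    + rewrite L; apply Rle_refl.
  - unfold Cdiv; rewrite <- !RtoC_inv by lra; destruct p, q; simpl; unfold Rdiv; ring.
Qed.

Lemma Cmod_beta_weight_le (p q b c : C) (t : R) :
  0 <= Re p -> 0 <= Re q -> 0 < t < 1 ->
  Cmod (beta_weight p q b c t) <=
    Rpower t (Re b - 1) * Rpower (1 - t) (Re c - Re b - 1).
Proof.
  intros Hp Hq Ht; unfold beta_weight; rewrite !Cmod_mult, !Cmod_cpow.
  replace (Re (b - 1)) with (Re b - 1) by (destruct b; reflexivity).
  replace (Re (c - b - 1)) with (Re c - Re b - 1) by (destruct b, c; reflexivity).
  rewrite <- (Rmult_1_r (Rpower t _ * _)) at 2; apply Rmult_le_compat_l.
  - apply Rlt_le, Rmult_lt_0_compat; apply exp_pos.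
  - apply Cmod_pq_weight_le_1; trivial.
Qed.

Lemma continuous_cpow (g : R -> R) (s : C) (t : R) :
  continuous g t -> 0 < g t ->
  continuous (U := C_R_NormedModule) (fun u => cpow (g u) s) t.
Proof.
  intros Hg Pg; apply continuous_Cexp, continuous_Cmult; [apply continuous_const|].
  apply continuous_RtoC, (continuous_comp g ln); trivial.
  apply continuous_ln, Pg.
Qed.

Lemma continuous_beta_weight (p q b c : C) (t : R) :
  0 < t < 1 -> continuous (U := C_R_NormedModule) (beta_weight p q b c) t.
Proof.
  intro Ht; apply continuous_Cmult; [apply continuous_Cmult|].
  - apply (continuous_cpow (fun u => u)); [apply continuous_id|lra].
  - apply (continuous_cpow (fun u => 1 - u)); [|lra].
    apply (ex_derive_continuous (V := R_NormedModule)); auto_derive; trivial.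
  - apply continuous_Cexp.
    assert (A : forall z : C, forall g : R -> R, continuous g t -> g t <> 0 ->
              continuous (U := C_R_NormedModule) (fun u => z * RtoC (/ g u))%C t).
    { intros z g Cg Ng; apply continuous_Cmult; [apply continuous_const|].
      apply continuous_RtoC, continuous_Rinv_comp; trivial. }
    apply (continuous_ext_loc _
      (fun u => plus (G := C_R_NormedModule)
         (opp (p * RtoC (/ u))) (opp (q * RtoC (/ (1 - u))))))%C.
    + assert (Hd : 0 < Rmin t (1 - t)) by (apply Rmin_glb_lt; lra).
      exists (mkposreal _ Hd); intros u Bu; apply Rabs_lt_between' in Bu; simpl in Bu.
      generalize (Rmin_l t (1 - t)) (Rmin_r t (1 - t)); intros L1 L2.
      unfold Cdiv, Cminus; rewrite !RtoC_inv by lra; reflexivity.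
    + apply (continuous_plus (V := C_R_NormedModule));
        apply (continuous_opp (V := C_R_NormedModule)); apply A; try lra.
      * apply continuous_id.
      * apply (ex_derive_continuous (V := R_NormedModule)); auto_derive; trivial.
Qed.

Section Weight.
Context (p q b c : C).
Context (Hp : 0 <= Re p) (Hq : 0 <= Re q) (Hb : 0 < Re b) (Hcb : Re b < Re c).

(** The functional is bounded for the supremum norm. This one estimate replaces a
    dominated convergence theorem everywhere below. *)
Lemma weighted_integral_bound (phi : R -> R) (M : R) :
  (forall t, 0 < t < 1 -> continuous phi t) ->
  (forall t, 0 < t < 1 -> Rabs (phi t) <= M) ->
  is_RInt_gen (V := C_R_NormedModule) (fun t => beta_weight p q b c t * RtoC (phi t))%C
    (at_right 0) (at_left 1) (weighted_integral p q b c phi) /\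
  Cmod (weighted_integral p q b c phi) <= M * weighted_mass b c.
Proof.
  intros Cphi Bphi; apply is_RInt_gen_beta_dominated; try lra.
  - intros t Ht; apply continuous_Cmult.
    + apply continuous_beta_weight, Ht.
    + apply continuous_RtoC, Cphi, Ht.
  - intros t Ht; rewrite Cmod_mult, Cmod_R, Rmult_comm; apply Rmult_le_compat.
    + apply Rabs_pos.
    + apply Cmod_ge_0.
    + apply Bphi, Ht.
    + apply Cmod_beta_weight_le; trivial.
Qed.

Lemma weighted_integral_correct (phi : R -> R) :
  bounded_continuous01 phi ->
  is_RInt_gen (V := C_R_NormedModule) (fun t => beta_weight p q b c t * RtoC (phi t))%C
    (at_right 0) (at_left 1) (weighted_integral p q b c phi).
Proof. intros [Cphi [M Bphi]]; apply (weighted_integral_bound phi M); trivial. Qed.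

Lemma weighted_integral_ext (phi psi : R -> R) :
  bounded_continuous01 phi -> (forall t, 0 < t < 1 -> phi t = psi t) ->
  weighted_integral p q b c phi = weighted_integral p q b c psi.
Proof.
  intros Bphi E; symmetry; apply CInt01_unique.
  apply (is_RInt_gen01_ext (fun t => beta_weight p q b c t * RtoC (phi t))%C).
  - intros t Ht; rewrite E; trivial.
  - apply weighted_integral_correct, Bphi.
Qed.

Lemma weighted_integral_linear (phi psi : R -> R) (k m : R) :
  bounded_continuous01 phi -> bounded_continuous01 psi ->
  weighted_integral p q b c (fun t => k * phi t + m * psi t) =
    (RtoC k * weighted_integral p q b c phi + RtoC m * weighted_integral p q b c psi)%C.
Proof.
  intros Bphi Bpsi; apply CInt01_unique.
  rewrite <- !scal_R_Cmult.
  apply (is_RInt_gen01_ext (fun t => plus (G := C_R_NormedModule)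
    (scal k (beta_weight p q b c t * RtoC (phi t))%C)
    (scal m (beta_weight p q b c t * RtoC (psi t))%C))).
  - intros t _; rewrite !scal_R_Cmult, RtoC_plus, !RtoC_mult.
    Cring.
  - apply (is_RInt_gen_plus (V := C_R_NormedModule));
      apply (is_RInt_gen_scal (V := C_R_NormedModule)); apply weighted_integral_correct; trivial.
Qed.

Lemma bounded_continuous01_linear (phi psi : R -> R) (k m : R) :
  bounded_continuous01 phi -> bounded_continuous01 psi ->
  bounded_continuous01 (fun t => k * phi t + m * psi t).
Proof.
  intros [Cphi [M HM]] [Cpsi [N HN]]; split.
  - intros t Ht; apply (continuous_plus (V := R_NormedModule));
      apply (continuous_scal_r (V := R_NormedModule)); auto.
  - exists (Rabs k * M + Rabs m * N); intros t Ht.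
    apply Rle_trans with (1 := Rabs_triang _ _); rewrite !Rabs_mult.
    apply Rplus_le_compat; apply Rmult_le_compat_l; auto using Rabs_pos.
Qed.
End Weight.

(** * The binomial series with remainder *)

(** The real Pochhammer symbol: for real [x] the complex one takes these values. *)
Fixpoint rising (x : R) (n : nat) : R :=
  match n with O => 1 | S m => rising x m * (x + INR m) end.

Lemma pochhammer_RtoC (x : R) (n : nat) : pochhammer (RtoC x) n = RtoC (rising x n).
Proof.
  induction n as [|n IH]; [reflexivity|].
  simpl pochhammer; rewrite IH, <- RtoC_plus, <- RtoC_mult; reflexivity.
Qed.

Lemma rising_pos (x : R) (n : nat) : 0 < x -> 0 < rising x n.
Proof.
  intro Hx; induction n as [|n IH]; simpl rising; [lra|].
  generalize (pos_INR n); intro; apply Rmult_lt_0_compat; lra.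
Qed.

(** The coefficient of [(- u) ^ n] in the expansion of [(1 + u) ^ (- lam)]. *)
Definition binomial_coef (lam : R) (n : nat) : R := rising lam n / INR (fact n).

Lemma binomial_coef_pos (lam : R) (n : nat) : 0 < lam -> 0 < binomial_coef lam n.
Proof.
  intro H; apply Rdiv_lt_0_compat; [apply rising_pos, H|apply lt_0_INR, lt_O_fact].
Qed.

Lemma binomial_coef_geom_lim (lam s : R) :
  0 < lam -> 0 < s < 1 -> is_lim_seq (fun n => binomial_coef lam n * s ^ n) 0.
Proof.
  intros Hl Hs.
  assert (P : forall n, 0 < binomial_coef lam n * s ^ n).
  { intro n; apply Rmult_lt_0_compat; [apply binomial_coef_pos, Hl|apply pow_lt; lra]. }
  apply ex_series_lim_0, ex_series_ext with (fun n => Rabs (binomial_coef lam n * s ^ n)).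
  { intro n; apply Rabs_pos_eq, Rlt_le, P. }
  apply ex_series_DAlembert with s; [lra|intro n; apply Rgt_not_eq, P|].
  apply is_lim_seq_ext with (fun n => s + s * (lam - 1) * / (INR n + 1)).
  { intro n; generalize (pos_INR n) (INR_fact_neq_0 n) (rising_pos lam n Hl)
      (pow_lt s n (proj1 Hs)).
    intros A B D E.
    rewrite Rabs_pos_eq.
    - unfold binomial_coef; simpl rising; rewrite fact_simpl, mult_INR, S_INR; simpl pow.
      field; repeat split; lra.
    - apply Rlt_le, Rdiv_lt_0_compat; apply P. }
  replace (Finite s) with (Finite (s + s * (lam - 1) * 0)) by (f_equal; ring).
  apply is_lim_seq_plus'; [apply is_lim_seq_const|].
  apply is_lim_seq_mult'; [apply is_lim_seq_const|].
  apply (is_lim_seq_ext (fun n => / INR (S n))).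
  { intro n; rewrite S_INR; reflexivity. }
  apply (is_lim_seq_incr_1 (fun n => / INR n)).
  apply (is_lim_seq_inv INR p_infty); [apply is_lim_seq_INR|discriminate].
Qed.

Lemma is_derive_n_Rpower_one_plus (lam : R) (n : nat) (y : R) :
  -1 < y ->
  ex_derive_n (fun u => Rpower (1 + u) (- lam)) n y /\
  Derive_n (fun u => Rpower (1 + u) (- lam)) n y =
    (-1) ^ n * rising lam n * Rpower (1 + y) (- lam - INR n).
Proof.
  revert y; induction n as [|n IH]; intros y Hy.
  - split; [exact I|]; simpl; rewrite Rminus_0_r; ring.
  - assert (L : locally y (fun t =>
        (-1) ^ n * rising lam n * Rpower (1 + t) (- lam - INR n) =
        Derive_n (fun u => Rpower (1 + u) (- lam)) n t)).
    { assert (Hd : 0 < y + 1) by lra.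
      exists (mkposreal _ Hd); intros z Bz; apply Rabs_lt_between' in Bz; simpl in Bz.
      symmetry; apply IH; lra. }
    assert (D : is_derive (fun t => (-1) ^ n * rising lam n * Rpower (1 + t) (- lam - INR n)) y
        ((-1) ^ S n * rising lam (S n) * Rpower (1 + y) (- lam - INR (S n)))).
    { replace (- lam - INR (S n)) with (- lam - INR n - 1) by (rewrite S_INR; ring).
      rewrite (Rpower_pred (1 + y)) by lra; unfold Rpower; auto_derive; [lra|].
      simpl; field; lra. }
    split.
    + apply ex_derive_ext_loc with (1 := L); eexists; exact D.
    + simpl Derive_n; rewrite <- (Derive_ext_loc _ _ _ L); apply is_derive_unique, D.
Qed.

(** Lagrange remainder at 0: the derivative is taken at an intermediate point [z > 0],
    where [Rpower (1 + z)] with negative exponent is at most 1. The bound is monotone in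
    [u], hence uniform over an interval. *)
Lemma binomial_remainder_le (lam u : R) (n : nat) :
  0 < lam -> 0 < u ->
  Rabs (Rpower (1 + u) (- lam) - sum_f_R0 (fun m => binomial_coef lam m * (- u) ^ m) n)
    <= binomial_coef lam (S n) * u ^ S n.
Proof.
  intros Hl Hu.
  destruct (Taylor_Lagrange (fun v => Rpower (1 + v) (- lam)) n 0 u Hu) as [z [Hz E]].
  { intros t Ht k _; apply is_derive_n_Rpower_one_plus; lra. }
  rewrite E, (proj2 (is_derive_n_Rpower_one_plus lam (S n) z ltac:(lra))), Rminus_0_r.
  rewrite (sum_eq _ (fun m => binomial_coef lam m * (- u) ^ m)).
  2: { intros i _; rewrite (proj2 (is_derive_n_Rpower_one_plus lam i 0 ltac:(lra))).
       rewrite Rplus_0_r, Rpower_1_l; unfold binomial_coef.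
       replace (- u) with (-1 * u) by ring; rewrite Rpow_mult_distr; field.
       apply INR_fact_neq_0. }
  unfold Rminus at 1; rewrite Rplus_comm, <- Rplus_assoc, Rplus_opp_l, Rplus_0_l.
  assert (P : 0 < u ^ S n / INR (fact (S n))).
  { apply Rdiv_lt_0_compat; [apply pow_lt, Hu|apply lt_0_INR, lt_O_fact]. }
  rewrite !Rabs_mult, pow_1_abs, Rmult_1_l, (Rabs_pos_eq _ (Rlt_le _ _ P)).
  rewrite (Rabs_pos_eq _ (Rlt_le _ _ (rising_pos lam (S n) Hl))).
  rewrite (Rabs_pos_eq (Rpower _ _)) by apply Rlt_le, exp_pos.
  assert (Q : Rpower (1 + z) (- lam - INR (S n)) <= 1).
  { replace (- lam - INR (S n)) with (- (lam + INR (S n))) by ring.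
    generalize (pos_INR (S n)); intro; rewrite Rpower_Ropp, <- Rinv_1.
    apply Rinv_le_contravar; [lra|].
    apply Rle_trans with (Rpower 1 (lam + INR (S n))); [rewrite Rpower_1_l; lra|].
    apply Rle_Rpower_l; lra. }
  replace (binomial_coef lam (S n) * u ^ S n)
    with (u ^ S n / INR (fact (S n)) * (rising lam (S n) * 1)).
  - apply Rmult_le_compat_l; [lra|].
    apply Rmult_le_compat_l; [apply Rlt_le, rising_pos, Hl|exact Q].
  - unfold binomial_coef; field; apply INR_fact_neq_0.
Qed.

(** * Series and integral representations agree *)

Lemma filterlim_C_of_bound (u : nat -> C) (l : C) (v : nat -> R) :
  (forall n, Cmod (u n - l) <= v n) -> is_lim_seq v 0 ->
  filterlim u eventually (locally (T := C_R_NormedModule) l).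
Proof.
  intros Hu Hv; apply (filterlim_locally (U := C_R_NormedModule)); intro eps.
  generalize (proj1 (filterlim_locally _ _) Hv eps); apply filter_imp; intros n Bn.
  apply (norm_compat1 (V := C_R_NormedModule)); rewrite <- Cmod_norm.
  apply Rle_lt_trans with (1 := Hu n).
  apply Rabs_lt_between' in Bn; lra.
Qed.

Lemma CSeries_unique (u : nat -> C) (l : C) :
  filterlim (sum_n (G := C_R_NormedModule) u) eventually (locally (T := C_R_NormedModule) l) ->
  CSeries u = l.
Proof. exact (iota_filterlim_locally (V := C_R_CompleteNormedModule) (sum_n u) l). Qed.

Lemma cpow_INR (t : R) (n : nat) : 0 < t -> cpow t (RtoC (INR n)) = RtoC (t ^ n).
Proof. intro Ht; rewrite cpow_RtoC, Rpower_pow; trivial. Qed.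

Lemma bounded_continuous01_pow (n : nat) : bounded_continuous01 (fun t => t ^ n).
Proof.
  split.
  - intros t _; apply (ex_derive_continuous (V := R_NormedModule)); auto_derive; trivial.
  - exists 1; intros t Ht; rewrite Rabs_pos_eq by (apply pow_le; lra).
    rewrite <- (pow1 n); apply pow_incr; lra.
Qed.

Lemma bounded_continuous01_polynomial (e : nat -> R) (n : nat) :
  bounded_continuous01 (fun t => sum_f_R0 (fun m => e m * t ^ m) n).
Proof.
  induction n as [|n IH]; simpl sum_f_R0.
  - destruct (bounded_continuous01_linear _ _ (e 0%nat) 0
      (bounded_continuous01_pow 0) (bounded_continuous01_pow 0)) as [A [M B]]; split.
    + intros t Ht; apply continuous_const.
    + exists (Rabs (e 0%nat * 1)); intros; apply Rle_refl.
  - destruct (bounded_continuous01_linear _ _ 1 (e (S n)) IH (bounded_continuous01_pow (S n)))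
      as [A [M B]]; split.
    + intros t Ht; generalize (A t Ht); apply continuous_ext; intro; simpl; ring.
    + exists M; intros t Ht; generalize (B t Ht); rewrite Rmult_1_l; trivial.
Qed.

Section Series.
Context (p q b c : C).
Context (Hp : 0 <= Re p) (Hq : 0 <= Re q) (Hb : 0 < Re b) (Hcb : Re b < Re c).

(** Raising the first Beta parameter by [n] multiplies the integrand by [t ^ n]. *)
Lemma Beta_pq_shift (n : nat) :
  Beta_pq (b + RtoC (INR n)) (c - b) p q = weighted_integral p q b c (fun t => t ^ n).
Proof.
  apply CInt01_unique.
  apply (is_RInt_gen01_ext (fun t => beta_weight p q b c t * RtoC (t ^ n))%C).
  - intros t Ht; unfold beta_weight; rewrite <- cpow_INR by apply Ht.
    replace (b + RtoC (INR n) - 1)%C with ((b - 1) + RtoC (INR n))%C by ring.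
    rewrite cpow_plus; ring.
  - apply weighted_integral_correct; trivial; apply bounded_continuous01_pow.
Qed.

Definition F_series_term (lam z : R) (n : nat) : C :=
  (pochhammer (RtoC lam) n * (Beta_pq (b + RtoC (INR n)) (c - b) p q / Beta b (c - b))
      * (RtoC z ^ n / RtoC (INR (fact n))))%C.

Lemma F_series_partial_sum (lam z : R) (n : nat) :
  sum_n (G := C_R_NormedModule) (F_series_term lam z) n =
    (/ Beta b (c - b) * weighted_integral p q b c
       (fun t => sum_f_R0 (fun m => binomial_coef lam m * (z * t) ^ m)%R n))%C.
Proof.
  assert (T : forall m, F_series_term lam z m =
    (/ Beta b (c - b) * (RtoC (binomial_coef lam m * z ^ m)%R *
       weighted_integral p q b c (fun t => (t ^ m)%R)))%C).
  { intro m; unfold F_series_term, binomial_coef, Cdiv.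
    rewrite pochhammer_RtoC, Beta_pq_shift; unfold Rdiv.
    rewrite !RtoC_mult, RtoC_inv, RtoC_pow by apply INR_fact_neq_0; ring. }
  transitivity (/ Beta b (c - b) * weighted_integral p q b c
       (fun t => sum_f_R0 (fun m => binomial_coef lam m * z ^ m * t ^ m)%R n))%C.
  - induction n as [|n IH].
    + rewrite sum_O, T; f_equal.
      rewrite (weighted_integral_ext p q b c Hp Hq Hb Hcb
        (fun t => sum_f_R0 (fun m => binomial_coef lam m * z ^ m * t ^ m) 0)
        (fun t => binomial_coef lam 0 * z ^ 0 * t ^ 0 + 0 * t ^ 0)).
      * rewrite weighted_integral_linear by auto using bounded_continuous01_pow; ring.
      * apply bounded_continuous01_polynomial.
      * intros; simpl; ring.
    + rewrite sum_Sn, IH, T.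
      change (plus ?x ?y) with (Cplus x y); rewrite <- Cmult_plus_distr_l; f_equal.
      rewrite (weighted_integral_ext p q b c Hp Hq Hb Hcb
        (fun t => sum_f_R0 (fun m => binomial_coef lam m * z ^ m * t ^ m) (S n))
        (fun t => 1 * sum_f_R0 (fun m => binomial_coef lam m * z ^ m * t ^ m) n +
           binomial_coef lam (S n) * z ^ S n * t ^ S n)).
      * rewrite weighted_integral_linear
          by auto using bounded_continuous01_pow, bounded_continuous01_polynomial; ring.
      * apply bounded_continuous01_polynomial.
      * intros; simpl; ring.
  - f_equal; apply weighted_integral_ext; trivial; [apply bounded_continuous01_polynomial|].
    intros t _; apply sum_eq; intros m _; rewrite Rpow_mult_distr; ring.
Qed.

Lemma bounded_continuous01_binomial (lam z : R) :
  0 < lam -> z < 0 -> bounded_continuous01 (fun t => Rpower (1 - z * t) (- lam)).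
Proof.
  intros Hl Hz; split.
  - intros t Ht; assert (0 < 1 - z * t) by nra.
    apply (ex_derive_continuous (V := R_NormedModule)); unfold Rpower; auto_derive; lra.
  - exists 1; intros t Ht; assert (1 < 1 - z * t) by nra.
    rewrite Rabs_pos_eq by apply Rlt_le, exp_pos.
    rewrite Rpower_Ropp, <- Rinv_1; apply Rinv_le_contravar; [lra|].
    apply Rle_trans with (Rpower 1 lam); [rewrite Rpower_1_l; lra|apply Rle_Rpower_l; lra].
Qed.

(** Equality of the series and integral representations on the negative axis. For
    [-1 < z < 0] the functional is applied to the Taylor remainder of the binomial series,
    which tends to 0 uniformly in [t]; for [z <= -1] the representation is the
    definition. *)
Lemma F_pq_weighted_integral (lam z : R) :
  0 < lam -> z < 0 ->
  F_pq p q (RtoC lam) b c z =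
    (/ Beta b (c - b) *
       weighted_integral p q b c (fun t => Rpower (1 - z * t) (- lam)))%C.
Proof.
  intros Hl Hz; assert (BC := bounded_continuous01_binomial lam z Hl Hz).
  unfold F_pq; destruct (Rle_dec z (-1)) as [Hz1|Hz1].
  - unfold F_integral; f_equal; apply CInt01_unique.
    apply (is_RInt_gen01_ext
      (fun t => beta_weight p q b c t * RtoC (Rpower (1 - z * t) (- lam)))%C).
    + intros t Ht; unfold beta_weight; rewrite cpow_RtoC, Rpower_Ropp, RtoC_inv.
      * unfold Cdiv; ring.
      * apply Rgt_not_eq, exp_pos.
    + apply weighted_integral_correct; trivial.
  - apply CSeries_unique.
    apply (filterlim_C_of_bound _ _ (fun n => Cmod (/ Beta b (c - b)) *
       (binomial_coef lam (S n) * (- z) ^ S n * weighted_mass b c))).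
    + intro n; fold (F_series_term lam z).
      change (fun n => F_series_term lam z n) with (F_series_term lam z).
      rewrite F_series_partial_sum.
      set (S := fun t => sum_f_R0 (fun m => binomial_coef lam m * (z * t) ^ m) n).
      set (G := fun t => Rpower (1 - z * t) (- lam)).
      assert (BS : bounded_continuous01 S).
      { destruct (bounded_continuous01_polynomial (fun m => binomial_coef lam m * z ^ m) n)
          as [A [M B]].
        assert (E : forall t, sum_f_R0 (fun m => binomial_coef lam m * z ^ m * t ^ m) n = S t).
        { intro t; apply sum_eq; intros m _; rewrite Rpow_mult_distr; ring. }
        split; [|exists M]; intros t Ht.
        - generalize (A t Ht); apply continuous_ext, E.
        - rewrite <- E; apply B, Ht. }
      replace (_ - _)%C with (/ Beta b (c - b) *
        weighted_integral p q b c (fun t => (-1) * G t + 1 * S t)%R)%C.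
      2: { rewrite weighted_integral_linear by trivial.
           change (-1) with (- (1)); rewrite RtoC_opp; ring. }
      rewrite Cmod_mult; apply Rmult_le_compat_l; [apply Cmod_ge_0|].
      apply weighted_integral_bound; trivial.
      * apply (bounded_continuous01_linear _ _ (-1) 1 BC BS).
      * intros t Ht; replace (-1 * G t + 1 * S t) with (- (G t - S t)) by ring.
        rewrite Rabs_Ropp; unfold G, S.
        replace (1 - z * t) with (1 + (- z * t)) by ring.
        rewrite (sum_eq _ (fun m => binomial_coef lam m * (- (- z * t)) ^ m)).
        2: { intros m _; f_equal; f_equal; ring. }
        apply Rle_trans with (1 := binomial_remainder_le lam (- z * t) n Hl ltac:(nra)).
        apply Rmult_le_compat_l; [apply Rlt_le, binomial_coef_pos, Hl|].
        apply pow_incr; nra.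
    + replace (Finite 0) with (Finite (Cmod (/ Beta b (c - b)) * (0 * weighted_mass b c)))
        by (f_equal; ring).
      apply is_lim_seq_mult'; [apply is_lim_seq_const|].
      apply is_lim_seq_mult'; [|apply is_lim_seq_const].
      apply (is_lim_seq_incr_1 (fun n => binomial_coef lam n * (- z) ^ n)).
      apply binomial_coef_geom_lim; lra.
Qed.
End Series.

(** * Differentiation of the Mathieu kernel *)

Lemma is_derive_of_quadratic_bound (f : R -> C) (x d M : R) (l : C) :
  0 < d ->
  (forall y, Rabs (y - x) < d -> Cmod (f y - f x - RtoC (y - x) * l) <= M * (y - x) ^ 2) ->
  is_derive (V := C_R_NormedModule) f x l.
Proof.
  intros Hd HM; split; [apply is_linear_scal_l|].
  intros y Hy; apply (is_filter_lim_locally_unique (V := R_NormedModule)) in Hy.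
  rewrite <- Hy; clear y Hy; intro eps.
  assert (Hd' : 0 < Rmin d (eps / (Rabs M + 1))).
  { generalize (Rabs_pos M); intro; apply Rmin_glb_lt; trivial.
    apply Rdiv_lt_0_compat; [apply cond_pos|lra]. }
  exists (mkposreal _ Hd'); intros y By.
  change (Rabs (y - x) < Rmin d (eps / (Rabs M + 1))) in By.
  rewrite <- Cmod_norm, scal_R_Cmult.
  change (Cmod (f y - f x - RtoC (y - x) * l) <= eps * Rabs (y - x)).
  assert (B1 := Rlt_le_trans _ _ _ By (Rmin_l _ _)).
  assert (B2 := Rlt_le_trans _ _ _ By (Rmin_r _ _)).
  apply Rle_trans with (1 := HM y B1).
  rewrite <- (pow2_abs (y - x)); simpl; rewrite Rmult_1_r, <- Rmult_assoc.
  apply Rmult_le_compat_r; [apply Rabs_pos|].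
  generalize (Rabs_pos M) (Rle_abs M) (Rabs_pos (y - x)); intros P1 P2 P3.
  apply Rmult_lt_compat_r with (r := Rabs M + 1) in B2; [|lra].
  unfold Rdiv in B2; rewrite Rmult_assoc, Rinv_l, Rmult_1_r in B2 by lra; nra.
Qed.

(** Two applications of the mean value theorem, which give the constant [M] where Taylor's
    formula would give [M / 2]. *)
Lemma quadratic_bound_of_second_derivative (f f1 f2 : R -> R) (x y M : R) :
  (forall z, Rmin x y <= z <= Rmax x y -> is_derive f z (f1 z)) ->
  (forall z, Rmin x y <= z <= Rmax x y -> is_derive f1 z (f2 z)) ->
  (forall z, Rmin x y <= z <= Rmax x y -> Rabs (f2 z) <= M) ->
  Rabs (f y - f x - (y - x) * f1 x) <= M * (y - x) ^ 2.
Proof.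
  intros D1 D2 B.
  assert (CP : forall (g g' : R -> R) z, is_derive g z (g' z) -> continuity_pt g z).
  { intros g g' z D; apply derivable_continuous_pt; exists (g' z); apply is_derive_Reals, D. }
  destruct (MVT_gen f x y f1) as [u [Hu Eu]].
  { intros z Hz; apply D1; lra. }
  { intros z Hz; apply (CP f f1), D1, Hz. }
  assert (I : forall z, Rmin x u <= z <= Rmax x u -> Rmin x y <= z <= Rmax x y).
  { intros z [H1 H2]; split.
    - apply Rle_trans with (2 := H1), Rmin_glb; [apply Rmin_l|lra].
    - apply Rle_trans with (1 := H2), Rmax_lub; [apply Rmax_l|lra]. }
  destruct (MVT_gen f1 x u f2) as [v [Hv Ev]].
  { intros z Hz; apply D2, I; lra. }
  { intros z Hz; apply (CP f1 f2), D2, I, Hz. }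
  replace (f y - f x - (y - x) * f1 x) with (f2 v * ((u - x) * (y - x)))
    by (rewrite Eu; replace (f1 u) with (f1 x + f2 v * (u - x)) by lra; ring).
  rewrite Rabs_mult; apply Rmult_le_compat; try apply Rabs_pos; [apply B, I, Hv|].
  rewrite <- (pow2_abs (y - x)), Rabs_mult; simpl; rewrite Rmult_1_r.
  apply Rmult_le_compat_r; [apply Rabs_pos|].
  revert Hu; unfold Rmin, Rmax; destruct (Rle_dec x y); intro Hu; unfold Rabs;
    destruct (Rcase_abs (u - x)), (Rcase_abs (y - x)); lra.
Qed.

(** With [s = r ^ 2 * t] and [S = r ^ 2] this is the dependence on [x] of the Mathieu
    kernel at a fixed integration variable [t]. *)
Definition shifted_power (lam eta s S x : R) : R :=
  Rpower (x + s) (- lam) * Rpower (x + S) (- eta).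

Lemma is_derive_shifted_power (lam eta s S x : R) :
  0 < x + s -> 0 < x + S ->
  is_derive (shifted_power lam eta s S) x
    (- lam * shifted_power (lam + 1) eta s S x + - eta * shifted_power lam (eta + 1) s S x).
Proof.
  intros H1 H2; unfold shifted_power.
  replace (- (lam + 1)) with (- lam - 1) by ring; replace (- (eta + 1)) with (- eta - 1) by ring.
  rewrite !Rpower_pred by trivial; unfold Rpower; auto_derive; [auto|].
  field; lra.
Qed.

Lemma shifted_power_bounds (lam eta s S x0 x : R) :
  0 < lam -> 0 < eta -> 0 <= s -> 0 <= S -> 0 < x0 <= x ->
  Rabs (shifted_power lam eta s S x) <= shifted_power lam eta 0 0 x0.
Proof.
  intros Hl He Hs HS Hx; unfold shifted_power; rewrite !Rplus_0_r.
  assert (A : forall k u, 0 < k -> 0 <= u -> 0 <= Rpower (x + u) (- k) <= Rpower x0 (- k)).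
  { intros k u Hk Hu; split; [apply Rlt_le, exp_pos|].
    rewrite !Rpower_Ropp; apply Rinv_le_contravar; [apply exp_pos|].
    apply Rle_Rpower_l; lra. }
  generalize (A lam s Hl Hs) (A eta S He HS); intros A1 A2.
  rewrite Rabs_pos_eq by (apply Rmult_le_pos; lra).
  apply Rmult_le_compat; lra.
Qed.

(** First-order Taylor estimate with a constant independent of the shifts, so that it
    survives integration over [t]. The second derivative is a combination of shifted
    powers, each decreasing in [x], in [s] and in [S]. *)
Lemma shifted_power_quadratic (lam eta x : R) :
  0 < lam -> 0 < eta -> 0 < x ->
  exists M, forall s S y, 0 <= s -> 0 <= S -> Rabs (y - x) < x / 2 ->
    Rabs (shifted_power lam eta s S y - shifted_power lam eta s S x -
      (y - x) * (- lam * shifted_power (lam + 1) eta s S x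
                 + - eta * shifted_power lam (eta + 1) s S x)) <= M * (y - x) ^ 2.
Proof.
  intros Hl He Hx.
  set (B := fun k m => shifted_power k m 0 0 (x / 2)).
  exists (lam * ((lam + 1) * B (lam + 1 + 1) eta + eta * B (lam + 1) (eta + 1)) +
          eta * (lam * B (lam + 1) (eta + 1) + (eta + 1) * B lam (eta + 1 + 1))).
  intros s S y Hs HS Hy; apply Rabs_lt_between' in Hy.
  assert (I : forall z, Rmin x y <= z <= Rmax x y -> x / 2 < z).
  { intros z [H1 _]; apply Rlt_le_trans with (2 := H1), Rmin_glb_lt; lra. }
  apply (quadratic_bound_of_second_derivative (shifted_power lam eta s S)
    (fun z => - lam * shifted_power (lam + 1) eta s S z +
              - eta * shifted_power lam (eta + 1) s S z)
    (fun z => - lam * (- (lam + 1) * shifted_power (lam + 1 + 1) eta s S z +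
                       - eta * shifted_power (lam + 1) (eta + 1) s S z) +
              - eta * (- lam * shifted_power (lam + 1) (eta + 1) s S z +
                       - (eta + 1) * shifted_power lam (eta + 1 + 1) s S z))).
  - intros z Hz; apply I in Hz; apply is_derive_shifted_power; lra.
  - intros z Hz; apply I in Hz.
    apply (is_derive_plus (V := R_NormedModule)
      (fun z => - lam * shifted_power (lam + 1) eta s S z)
      (fun z => - eta * shifted_power lam (eta + 1) s S z));
      apply (is_derive_scal (fun z => shifted_power _ _ s S z));
      apply is_derive_shifted_power; lra.
  - intros z Hz; apply I in Hz.
    assert (A : forall k m, 0 < k -> 0 < m -> Rabs (shifted_power k m s S z) <= B k m).
    { intros k m Hk Hm; apply shifted_power_bounds; lra. }
    assert (A1 := A (lam + 1 + 1) eta ltac:(lra) ltac:(lra)).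
    assert (A2 := A (lam + 1) (eta + 1) ltac:(lra) ltac:(lra)).
    assert (A3 := A lam (eta + 1 + 1) ltac:(lra) ltac:(lra)).
    apply Rabs_le_between in A1, A2, A3.
    assert (T : forall k u v, 0 < k -> - v <= u <= v -> - (k * v) <= k * u <= k * v)
      by (intros; nra).
    apply (T (lam * (lam + 1))) in A1; [|nra].
    apply (T (eta * (eta + 1))) in A3; [|nra].
    apply (T (lam * eta)) in A2; [|nra].
    apply Rabs_le_between; lra.
Qed.

Section Kernel.
Context (p q b c : C).
Context (Hp : 0 <= Re p) (Hq : 0 <= Re q) (Hb : 0 < Re b) (Hcb : Re b < Re c).

Lemma bounded_continuous01_shifted_power (lam eta r x : R) :
  0 < lam -> 0 < eta -> 0 < r -> 0 < x ->
  bounded_continuous01 (fun t => shifted_power lam eta (r ^ 2 * t) (r ^ 2) x).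
Proof.
  intros Hl He Hr Hx; assert (Hr2 : 0 < r ^ 2) by (apply pow_lt, Hr); split.
  - intros t Ht; assert (0 < r ^ 2 * t) by nra.
    apply (ex_derive_continuous (V := R_NormedModule)); unfold shifted_power, Rpower.
    auto_derive; lra.
  - exists (shifted_power lam eta 0 0 x); intros t Ht; apply shifted_power_bounds; nra.
Qed.

(** Absorbing [x ^ (- lam)] into [(1 + r ^ 2 * t / x) ^ (- lam)] leaves
    [(x + r ^ 2 * t) ^ (- lam)], whose derivative in [x] is elementary. *)
Lemma mathieu_kernel_weighted_integral (lam eta r x : R) :
  0 < lam -> 0 < eta -> 0 < r -> 0 < x ->
  mathieu_kernel p q b c r lam eta x =
    (/ Beta b (c - b) * weighted_integral p q b c
       (fun t => shifted_power lam eta (r ^ 2 * t)%R (r ^ 2)%R x))%C.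
Proof.
  intros Hl He Hr Hx; assert (Hr2 : 0 < r ^ 2) by (apply pow_lt, Hr).
  assert (Hz : - (r ^ 2 / x) < 0).
  { apply Ropp_lt_gt_0_contravar, Rdiv_lt_0_compat; trivial. }
  assert (BC := bounded_continuous01_binomial lam _ Hl Hz).
  unfold mathieu_kernel; rewrite F_pq_weighted_integral by trivial.
  set (k := / (Rpower x lam * Rpower (x + r ^ 2) eta)).
  assert (P : Rpower x lam * Rpower (x + r ^ 2) eta <> 0).
  { apply Rmult_integral_contrapositive; split; apply Rgt_not_eq, exp_pos. }
  unfold Cdiv; rewrite <- RtoC_inv by exact P; fold k.
  rewrite (weighted_integral_ext p q b c Hp Hq Hb Hcb
    (fun t => shifted_power lam eta (r ^ 2 * t) (r ^ 2) x)
    (fun t => k * Rpower (1 - - (r ^ 2 / x) * t) (- lam) +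
              0 * Rpower (1 - - (r ^ 2 / x) * t) (- lam))).
  - rewrite weighted_integral_linear by trivial; ring.
  - apply bounded_continuous01_shifted_power; trivial.
  - intros t Ht; rewrite Rmult_0_l, Rplus_0_r; unfold k, shifted_power.
    assert (Hu : 0 < 1 - - (r ^ 2 / x) * t) by nra.
    replace (x + r ^ 2 * t) with (x * (1 - - (r ^ 2 / x) * t)) by (field; lra).
    rewrite <- Rpower_mult_distr by trivial.
    rewrite (Rpower_Ropp x), (Rpower_Ropp (x + r ^ 2)), Rinv_mult; ring.
Qed.

(** Differentiation under the integral sign: the functional is applied to the first-order
    Taylor remainder in [x], which is quadratic uniformly in [t]. *)
Lemma is_derive_mathieu_kernel (lam eta r x : R) :
  0 < lam -> 0 < eta -> 0 < r -> 0 < x ->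
  is_derive (V := C_R_NormedModule) (mathieu_kernel p q b c r lam eta) x
    (- (RtoC lam * mathieu_kernel p q b c r (lam + 1) eta x +
        RtoC eta * mathieu_kernel p q b c r lam (eta + 1) x))%C.
Proof.
  intros Hl He Hr Hx; assert (Hr2 : 0 < r ^ 2) by (apply pow_lt, Hr).
  destruct (shifted_power_quadratic lam eta x Hl He Hx) as [M HM].
  apply (is_derive_of_quadratic_bound _ x (x / 2)
    (Cmod (/ Beta b (c - b)) * (M * weighted_mass b c))); [lra|].
  intros y Hy; assert (Hy0 : 0 < y) by (apply Rabs_lt_between' in Hy; lra).
  rewrite !mathieu_kernel_weighted_integral by lra.
  set (f := fun lam eta x t => shifted_power lam eta (r ^ 2 * t) (r ^ 2) x).
  assert (BC : forall k m z, 0 < k -> 0 < m -> 0 < z -> bounded_continuous01 (f k m z)).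
  { intros; apply bounded_continuous01_shifted_power; trivial. }
  (* [D] is the Taylor remainder, grouped as nested two-term combinations so that linearity
     applies. *)
  set (D := fun t => (y - x) * (lam * f (lam + 1) eta x t + eta * f lam (eta + 1) x t) +
      1 * (1 * f lam eta y t + -1 * f lam eta x t)).
  assert (BD : bounded_continuous01 D).
  { repeat apply bounded_continuous01_linear; apply BC; lra. }
  replace (_ - _ - _)%C with (/ Beta b (c - b) * weighted_integral p q b c D)%C.
  - rewrite Cmod_mult, Rmult_assoc; apply Rmult_le_compat_l; [apply Cmod_ge_0|].
    replace (M * weighted_mass b c * (y - x) ^ 2)
      with (M * (y - x) ^ 2 * weighted_mass b c) by ring.
    apply weighted_integral_bound; trivial; [apply BD|].
    intros t Ht; generalize (HM (r ^ 2 * t) (r ^ 2) y ltac:(nra) ltac:(lra) Hy).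
    apply Rle_trans; right; f_equal; unfold D, f; ring.
  - assert (BL : forall k m k' m' k'' m'' z z',
      0 < k -> 0 < m -> 0 < z -> 0 < k' -> 0 < m' -> 0 < z' ->
      bounded_continuous01 (fun t => k'' * f k m z t + m'' * f k' m' z' t)).
    { intros; apply bounded_continuous01_linear; apply BC; lra. }
    unfold D; rewrite weighted_integral_linear by (trivial; apply BL; lra).
    rewrite !weighted_integral_linear by (trivial; apply BC; lra).
    fold (f (lam + 1) eta x) (f lam (eta + 1) x) (f lam eta x) (f lam eta y).
    change (-1) with (- (1)); rewrite RtoC_opp; ring.
Qed.

Lemma continuous_mathieu_kernel (lam eta r x : R) :
  0 < lam -> 0 < eta -> 0 < r -> 0 < x ->
  continuous (U := C_R_NormedModule) (mathieu_kernel p q b c r lam eta) x.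
Proof.
  intros Hl He Hr Hx; apply (ex_derive_continuous (V := C_R_NormedModule)).
  eexists; apply is_derive_mathieu_kernel; trivial.
Qed.
End Kernel.

(** * Abel summation *)

(** If [n * u n] stayed above [L / 2 > 0], every block of [n] terms from index [n + 1]
    to [2 * n] would add at least [L / 4], against the Cauchy criterion. *)
Lemma not_pos_lim_index_mul_series_term (u : nat -> R) (T L : R) :
  is_lim_seq (sum_n u) T -> is_lim_seq (fun n => INR (S n) * u (S n)) L -> ~ 0 < L.
Proof.
  intros HT HL PL.
  assert (E1 : 0 < L / 2) by lra.
  assert (E2 : 0 < L / 8) by lra.
  destruct (proj1 (filterlim_locally _ _) HL (mkposreal _ E1)) as [N1 B1].
  destruct (proj1 (filterlim_locally _ _) HT (mkposreal _ E2)) as [N2 B2].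
  set (n := S (N1 + N2)).
  assert (Hn : 0 < INR n) by (apply lt_0_INR; unfold n; lia).
  (* Each index in the block is at most [2 * n], so each term is at least
     [L / 2 / (2 * n)]. *)
  assert (G : forall k, (k <= n)%nat ->
            sum_n u n + INR k * (L / 2 / (2 * INR n)) <= sum_n u (n + k)).
  { induction k as [|k IH]; intro Hk.
    - rewrite Nat.add_0_r; simpl; lra.
    - rewrite Nat.add_succ_r, sum_Sn; change (plus ?x ?y) with (x + y).
      apply Rle_trans with (sum_n u (n + k) + L / 2 / (2 * INR n)).
      + rewrite S_INR; generalize (IH ltac:(lia)); lra.
      + apply Rplus_le_compat_l.
        assert (B := B1 (n + k)%nat ltac:(unfold n; lia)).
        apply Rabs_lt_between' in B.
        change (L - L / 2 < INR (S (n + k)) * u (S (n + k)) < L + L / 2) in B.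
        assert (Hm : 0 < INR (S (n + k))) by (apply lt_0_INR; lia).
        assert (Hm2 : INR (S (n + k)) <= 2 * INR n).
        { change 2 with (INR 2); rewrite <- mult_INR; apply le_INR; lia. }
        apply Rle_trans with (L / 2 / INR (S (n + k))).
        * apply Rmult_le_compat_l; [lra|]; apply Rinv_le_contravar; lra.
        * apply Rmult_le_reg_r with (INR (S (n + k))); [lra|].
          unfold Rdiv; rewrite Rmult_assoc, Rinv_l by lra; lra. }
  assert (A := G n (le_n n)).
  replace (INR n * (L / 2 / (2 * INR n))) with (L / 4) in A by (field; lra).
  assert (C1 := B2 n ltac:(unfold n; lia)); assert (C2 := B2 (n + n)%nat ltac:(unfold n; lia)).
  apply Rabs_lt_between' in C1, C2.
  change (T - L / 8 < sum_n u n < T + L / 8) in C1.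
  change (T - L / 8 < sum_n u (n + n) < T + L / 8) in C2.
  lra.
Qed.

Lemma lim_index_mul_series_term (u : nat -> R) (T L : R) :
  is_lim_seq (sum_n u) T -> is_lim_seq (fun n => INR (S n) * u (S n)) L -> L = 0.
Proof.
  intros HT HL.
  assert (N1 := not_pos_lim_index_mul_series_term u T L HT HL).
  assert (N2 : ~ 0 < - L).
  { apply (not_pos_lim_index_mul_series_term (fun n => - u n) (- T)).
    - apply (is_lim_seq_ext (fun n => - sum_n u n)).
      + induction n as [|n IH]; [rewrite !sum_O; reflexivity|].
        rewrite !sum_Sn, <- IH; change (plus ?x ?y) with (x + y); ring.
      + apply (is_lim_seq_opp _ T), HT.
    - apply (is_lim_seq_ext (fun n => - (INR (S n) * u (S n)))); [intro; ring|].
      apply (is_lim_seq_opp _ L), HL. }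
  lra.
Qed.

Lemma Re_sum_n (u : nat -> C) (n : nat) :
  Re (sum_n (G := C_R_NormedModule) u n) = sum_n (fun k => Re (u k)) n.
Proof.
  induction n as [|n IH]; [rewrite !sum_O; reflexivity|].
  rewrite !sum_Sn, <- IH; reflexivity.
Qed.

Lemma Im_sum_n (u : nat -> C) (n : nat) :
  Im (sum_n (G := C_R_NormedModule) u n) = sum_n (fun k => Im (u k)) n.
Proof.
  induction n as [|n IH]; [rewrite !sum_O; reflexivity|].
  rewrite !sum_Sn, <- IH; reflexivity.
Qed.

(** The partial sums of the two series differ by [(n + 1) * u (n + 1)]. This difference
    converges because both series do, and its limit is 0 because the series of [u]
    converges. *)
Lemma abel_limit_index (u : nat -> C) (T L : C) :
  filterlim (sum_n (G := C_R_NormedModule) u) eventually (locally (T := C_R_NormedModule) T) ->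
  filterlim (sum_n (G := C_R_NormedModule)
      (fun j => RtoC (INR (S j)) * (u j - u (S j)))%C)
    eventually (locally (T := C_R_NormedModule) L) ->
  T = L.
Proof.
  intros HT HL.
  assert (E : forall n, sum_n (G := C_R_NormedModule)
      (fun j => RtoC (INR (S j)) * (u j - u (S j)))%C n =
      (sum_n (G := C_R_NormedModule) u n - RtoC (INR (S n)) * u (S n))%C).
  { induction n as [|n IH].
    - rewrite !sum_O; change (INR 1) with 1; Cring.
    - rewrite !sum_Sn, IH.
      rewrite (S_INR (S n)), RtoC_plus; Cring. }
  (* The real statement is applied to each of the two coordinates. *)
  assert (Z : forall pr : C -> R, (forall n, pr (sum_n (G := C_R_NormedModule) u n) =
                sum_n (fun k => pr (u k)) n) ->
              (forall v l, filterlim v eventually (locally (T := C_R_NormedModule) l) ->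
                 is_lim_seq (fun n => pr (v n)) (pr l)) ->
              (forall n z w, pr (z - RtoC (INR n) * w)%C = pr z - INR n * pr w) ->
              pr T = pr L).
  { intros pr prS prL prM; apply Rminus_diag_uniq.
    apply (lim_index_mul_series_term (fun n => pr (u n)) (pr T)).
    - apply (is_lim_seq_ext (fun n => pr (sum_n (G := C_R_NormedModule) u n))); [exact prS|].
      apply prL, HT.
    - apply (is_lim_seq_ext (fun n => pr (sum_n (G := C_R_NormedModule) u n) -
          pr (sum_n (G := C_R_NormedModule)
            (fun j => RtoC (INR (S j)) * (u j - u (S j)))%C n))).
      + intro n; rewrite E, prM; ring.
      + apply is_lim_seq_minus'; apply prL; assumption. }
  apply C_eq; apply Z.
  - apply Re_sum_n.
  - exact (filterlim_Re eventually).
  - intros n [z1 z2] [w1 w2]; simpl; ring.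
  - apply Im_sum_n.
  - exact (filterlim_Im eventually).
  - intros n [z1 z2] [w1 w2]; simpl; ring.
Qed.

Lemma sin2_half_pi_even (n : nat) : sin (PI / 2 * INR (2 * n)) ^ 2 = 0.
Proof.
  induction n as [|n IH].
  - simpl (INR _); rewrite Rmult_0_r, sin_0; ring.
  - rewrite <- IH; replace (2 * S n)%nat with (2 * n + 2)%nat by lia.
    rewrite plus_INR; simpl (INR 2).
    replace (PI / 2 * (INR (2 * n) + (1 + 1))) with (PI / 2 * INR (2 * n) + PI) by field.
    rewrite neg_sin; ring.
Qed.

Lemma sin2_half_pi_odd (n : nat) : sin (PI / 2 * INR (S (2 * n))) ^ 2 = 1.
Proof.
  assert (S0 : sin (PI / 2 * INR (2 * n)) = 0).
  { generalize (sin2_half_pi_even n); intro E; simpl in E; rewrite Rmult_1_r in E.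
    apply Rmult_integral in E; tauto. }
  rewrite S_INR, Rmult_plus_distr_l, Rmult_1_r, Rplus_comm.
  rewrite sin_plus, S0, sin_PI2, cos_PI2.
  generalize (sin2_cos2 (PI / 2 * INR (2 * n))); rewrite S0; unfold Rsqr; nra.
Qed.

(** The weight is 1 at odd and 0 at even positive integers, so the weighted differences
    group the alternating series in consecutive pairs. Partial sums ending at the last
    term of a pair agree exactly, without a boundary term. *)
Lemma abel_limit_alternating (u : nat -> C) (T L : C) :
  filterlim (sum_n (G := C_R_NormedModule) (fun j => RtoC ((-1) ^ j) * u j)%C)
    eventually (locally (T := C_R_NormedModule) T) ->
  filterlim (sum_n (G := C_R_NormedModule)
      (fun j => RtoC (sin (PI / 2 * INR (S j)) ^ 2) * (u j - u (S j)))%C)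
    eventually (locally (T := C_R_NormedModule) L) ->
  T = L.
Proof.
  intros HT HL.
  assert (E : forall n, sum_n (G := C_R_NormedModule)
      (fun j => RtoC (sin (PI / 2 * INR (S j)) ^ 2) * (u j - u (S j)))%C (2 * n) =
      sum_n (G := C_R_NormedModule) (fun j => RtoC ((-1) ^ j) * u j)%C (S (2 * n))).
  { induction n as [|n IH].
    - generalize (sin2_half_pi_odd 0); change (2 * 0)%nat with 0%nat; intro S1.
      rewrite sum_Sn, !sum_O, S1.
      change (plus ?x ?y) with (Cplus x y); apply C_eq; simpl; ring.
    - replace (2 * S n)%nat with (S (S (2 * n))) by lia.
      rewrite !(sum_Sn _ (S _)), <- IH, sum_Sn.
      replace (S (S (2 * n))) with (2 * S n)%nat by lia.
      rewrite sin2_half_pi_even, sin2_half_pi_odd, pow_1_odd, pow_1_even.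
      change (-1) with (- (1)); rewrite RtoC_opp.
      Cring. }
  assert (D1 : filterlim (fun n => S (2 * n)) eventually eventually).
  { intros P [N HN]; exists N; intros n Hn; apply HN; lia. }
  assert (D2 : filterlim (fun n => (2 * n)%nat) eventually eventually).
  { intros P [N HN]; exists N; intros n Hn; apply HN; lia. }
  apply (filterlim_locally_unique (V := C_R_NormedModule) (F := eventually)
    (fun n => sum_n (G := C_R_NormedModule) (fun j => RtoC ((-1) ^ j) * u j)%C (S (2 * n)))).
  - apply (filterlim_comp _ _ _ _ _ _ _ _ D1 HT).
  - apply (filterlim_ext _ _ E), (filterlim_comp _ _ _ _ _ _ _ _ D2 HL).
Qed.

Lemma filterlim_of_is_RInt_gen_infty {V : CompleteNormedModule R_AbsRing}
  (g : R -> V) (x0 : R) (I : V) (v : nat -> R) (y : nat -> V) :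
  is_RInt_gen g (at_point x0) (Rbar_locally p_infty) I ->
  is_lim_seq v p_infty -> (forall n, is_RInt g x0 (v n) (y n)) ->
  filterlim y eventually (locally I).
Proof.
  intros HI Hv Hy.
  assert (Hc : filterlim (fun n => (x0, v n)) eventually
                 (filter_prod (at_point x0) (Rbar_locally p_infty))).
  { apply filterlim_pair; [|exact Hv].
    intros P HP; exists 0%nat; intros n _; exact HP. }
  generalize (filterlimi_comp _ _ _ _ _ _ _ _ Hc HI); simpl; intro H.
  intros P HP; generalize (H P HP); unfold filtermapi, filtermap.
  apply filter_imp; intros n [z [Hz Pz]].
  rewrite <- (is_RInt_unique _ _ _ _ (Hy n)), (is_RInt_unique _ _ _ _ Hz); exact Pz.
Qed.

(** Abel summation in integral form: the weight is constant between consecutive nodes, and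
    the fundamental theorem of calculus applies on each piece. *)
Lemma is_RInt_step_weighted_derivative {V : CompleteNormedModule R_AbsRing}
  (K k g : R -> V) (v w : nat -> R) :
  (forall n, v n <= v (S n)) ->
  (forall x, v 0%nat <= x -> is_derive K x (opp (k x))) ->
  (forall x, v 0%nat <= x -> continuous k x) ->
  (forall n x, v n < x < v (S n) -> g x = scal (w n) (k x)) ->
  forall n, is_RInt g (v 0%nat) (v (S n))
    (sum_n (fun j => scal (w j) (minus (K (v j)) (K (v (S j))))) n).
Proof.
  intros Hv HK Hk Hg.
  assert (H0 : forall n, v 0%nat <= v n).
  { induction n as [|n IH]; [lra|]; generalize (Hv n); lra. }
  assert (P : forall n, is_RInt g (v n) (v (S n)) (scal (w n) (minus (K (v n)) (K (v (S n)))))).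
  { intro n; apply (is_RInt_ext (fun x => scal (w n) (k x))).
    - intros x; rewrite Rmin_left, Rmax_right by apply Hv; intro Hx; symmetry; apply Hg, Hx.
    - apply (is_RInt_scal k), (is_RInt_ext (fun x => opp (opp (k x)))).
      + intros x _; apply opp_opp.
      + replace (minus (K (v n)) (K (v (S n)))) with (opp (minus (K (v (S n))) (K (v n))))
          by apply opp_minus.
        apply (is_RInt_opp (fun x => opp (k x))), is_RInt_derive;
          intros x; rewrite Rmin_left by apply Hv; intro Hx;
          assert (v 0%nat <= x) by (generalize (H0 n); lra).
        * apply HK; trivial.
        * apply (continuous_opp k), Hk; trivial. }
  induction n as [|n IH].
  - rewrite sum_O; apply P.
  - rewrite sum_Sn.
    apply (is_RInt_Chasles (V := CompleteNormedModule.NormedModule _ V)) with (v (S n));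
      [exact IH|apply P].
Qed.

Lemma Int_part_inverse (a ainv : R -> R) (n : nat) (x : R) :
  (1 <= n)%nat -> (forall x y, 0 < x -> x <= y -> a x <= a y) ->
  0 < ainv x -> a (ainv x) = x -> a (INR n) < x < a (INR (S n)) ->
  Int_part (ainv x) = Z.of_nat n.
Proof.
  intros Hn Ha H0 E Hx; symmetry; apply Int_part_spec; rewrite <- INR_IZR_INZ.
  assert (Pn : 0 < INR n) by (apply lt_0_INR; lia).
  rewrite S_INR in Hx; split.
  - apply Rnot_le_lt; intro L.
    generalize (Ha (INR n + 1) (ainv x) ltac:(lra) ltac:(lra)); lra.
  - apply Rnot_lt_le; intro L.
    generalize (Ha (ainv x) (INR n) H0 ltac:(lra)); lra.
Qed.

(** The common part of the two identities, for an arbitrary weight [w] of the integer part: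
    [w] is the identity for the plain series and the squared sine for the alternating one. *)
Lemma mathieu_abel_limit (lam eta r : R) (b c p q : C) (a_ : nat -> R) (a ainv : R -> R)
  (w : Z -> R) :
  0 < lam -> 0 < eta -> 0 < r -> 0 <= Re p -> 0 <= Re q -> 0 < Re b -> Re b < Re c ->
  0 < a_ 1%nat ->
  (forall n : nat, (1 <= n)%nat -> a_ n <= a_ (S n)) ->
  is_lim_seq a_ p_infty ->
  (forall x y : R, 0 < x -> x <= y -> a x <= a y) ->
  (forall n : nat, (1 <= n)%nat -> a (INR n) = a_ n) ->
  (forall x : R, a_ 1%nat <= x -> 0 < ainv x /\ a (ainv x) = x) ->
  let f lam eta x := (mathieu_kernel p q b c r lam eta x * RtoC (w (Int_part (ainv x))))%C in
  ex_CInt_infty (f (lam + 1) eta) (a_ 1%nat) ->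
  ex_CInt_infty (f lam (eta + 1)) (a_ 1%nat) ->
  filterlim (sum_n (G := C_R_NormedModule) (fun j => RtoC (w (Z.of_nat (S j))) *
      (mathieu_term p q b c a_ r lam eta j - mathieu_term p q b c a_ r lam eta (S j)))%C)
    eventually (locally (T := C_R_NormedModule)
      (RtoC lam * CInt_infty (f (lam + 1)%R eta) (a_ 1%nat) +
       RtoC eta * CInt_infty (f lam (eta + 1)%R) (a_ 1%nat))%C).
Proof.
  intros Hl He Hr Hp Hq Hb Hcb H1 Hincr Hlim Ha Has Hinv f [I1 HI1] [I2 HI2].
  set (k := fun x => (RtoC lam * mathieu_kernel p q b c r (lam + 1) eta x +
                      RtoC eta * mathieu_kernel p q b c r lam (eta + 1) x)%C).
  unfold CInt_infty.
  rewrite (is_RInt_gen_unique (V := C_R_CompleteNormedModule) _ _ HI1).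
  rewrite (is_RInt_gen_unique (V := C_R_CompleteNormedModule) _ _ HI2).
  rewrite <- !scal_R_Cmult.
  apply (filterlim_of_is_RInt_gen_infty (V := C_R_CompleteNormedModule)
    (fun x => plus (G := C_R_NormedModule) (scal lam (f (lam + 1) eta x))
                (scal eta (f lam (eta + 1) x))) (a_ 1%nat) _ (fun n => a_ (S (S n)))).
  - apply (is_RInt_gen_plus (V := C_R_NormedModule));
      apply (is_RInt_gen_scal (V := C_R_NormedModule)); assumption.
  - apply (is_lim_seq_incr_1 (fun n => a_ (S n))), (is_lim_seq_incr_1 a_), Hlim.
  - intro n.
    generalize (is_RInt_step_weighted_derivative (V := C_R_CompleteNormedModule)
      (mathieu_kernel p q b c r lam eta) k
      (fun x => plus (G := C_R_NormedModule) (scal lam (f (lam + 1) eta x))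
                (scal eta (f lam (eta + 1) x)))
      (fun n => a_ (S n)) (fun n => w (Z.of_nat (S n)))); intro S.
    match type of S with ?A -> ?B -> ?D -> ?E -> _ =>
      assert (S1 : A); [|assert (S2 : B); [|assert (S3 : D); [|assert (S4 : E)]]] end.
    + intro m; apply Hincr; lia.
    + intros x Hx; apply (is_derive_mathieu_kernel p q b c); trivial; lra.
    + intros x Hx; apply (continuous_plus (V := C_R_NormedModule));
        apply continuous_Cmult; try apply continuous_const;
        apply continuous_mathieu_kernel; trivial; lra.
    + intros m x Hx; unfold f, k.
      assert (Hx1 : a_ 1%nat <= x).
      { assert (M : a_ 1%nat <= a_ (Datatypes.S m)).
        { clear Hx; induction m as [|m IH]; [lra|].
          generalize (Hincr (Datatypes.S m) ltac:(lia)); lra. }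
        lra. }
      destruct (Hinv x Hx1) as [P E].
      rewrite (Int_part_inverse a ainv (Datatypes.S m) x); trivial; [|lia|].
      * rewrite !scal_R_Cmult; Cring.
      * rewrite !Has by lia; exact Hx.
    + generalize (S S1 S2 S3 S4 n).
      match goal with |- is_RInt _ _ _ ?u -> is_RInt _ _ _ ?v => replace v with u; [trivial|] end.
      apply sum_n_ext; intro j; rewrite scal_R_Cmult; reflexivity.
Qed.

Theorem theorem2p1 (lam eta r : R) (b c p q : C)
  (a_ : nat -> R) (a ainv : R -> R)
  (Hlam : 0 < lam) (Heta : 0 < eta) (Hr : 0 < r)
  (Hb : 0 < Re b) (Hcb : Re b < Re c)
  (Hpq : 0 <= Rmin (Re p) (Re q))
  (Hseq_pos : forall n : nat, (1 <= n)%nat -> 0 < a_ n)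
  (Hseq_incr : forall n : nat, (1 <= n)%nat -> a_ n <= a_ (S n))
  (Hseq_lim : is_lim_seq a_ p_infty)
  (Ha_pos : forall x : R, 0 < x -> 0 < a x)
  (Ha_incr : forall x y : R, 0 < x -> x <= y -> a x <= a y)
  (Ha_seq : forall n : nat, (1 <= n)%nat -> a (INR n) = a_ n)
  (Hinv_r : forall x : R, a_ 1%nat <= x -> 0 < ainv x /\ a (ainv x) = x)
  (Hinv_l : forall y : R, 0 < y -> a_ 1%nat <= a y -> ainv (a y) = y) :
  (ex_series (V := C_R_NormedModule) (mathieu_term p q b c a_ r lam eta) ->
   ex_CInt_infty (I_integrand p q b c ainv r (lam + 1) eta) (a_ 1%nat) ->
   ex_CInt_infty (I_integrand p q b c ainv r lam (eta + 1)) (a_ 1%nat) ->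
   mathieu_series p q b c a_ r lam eta =
     (RtoC lam * CInt_infty (I_integrand p q b c ainv r (lam + 1) eta) (a_ 1%nat)
      + RtoC eta * CInt_infty (I_integrand p q b c ainv r lam (eta + 1)) (a_ 1%nat))%C)
  /\
  (ex_series (V := C_R_NormedModule) (alt_mathieu_term p q b c a_ r lam eta) ->
   ex_CInt_infty (alt_I_integrand p q b c ainv r (lam + 1) eta) (a_ 1%nat) ->
   ex_CInt_infty (alt_I_integrand p q b c ainv r lam (eta + 1)) (a_ 1%nat) ->
   alt_mathieu_series p q b c a_ r lam eta =
     (RtoC lam * CInt_infty (alt_I_integrand p q b c ainv r (lam + 1) eta) (a_ 1%nat)
      + RtoC eta * CInt_infty (alt_I_integrand p q b c ainv r lam (eta + 1)) (a_ 1%nat))%C).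
Proof.
  assert (Hp : 0 <= Re p) by (apply Rle_trans with (1 := Hpq), Rmin_l).
  assert (Hq : 0 <= Re q) by (apply Rle_trans with (1 := Hpq), Rmin_r).
  assert (H1 : 0 < a_ 1%nat) by (apply Hseq_pos; lia).
  split; intros [T HT] HI1 HI2.
  - transitivity T; [apply CSeries_unique, HT|].
    apply (abel_limit_index _ _ _ HT).
    generalize (mathieu_abel_limit lam eta r b c p q a_ a ainv IZR
      Hlam Heta Hr Hp Hq Hb Hcb H1 Hseq_incr Hseq_lim Ha_incr Ha_seq Hinv_r HI1 HI2).
    apply filterlim_ext; intro n; apply sum_n_ext; intro j; rewrite <- INR_IZR_INZ; reflexivity.
  - transitivity T; [apply CSeries_unique, HT|].
    apply (abel_limit_alternating _ _ _ HT).
    generalize (mathieu_abel_limit lam eta r b c p q a_ a ainv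
      (fun z => sin (PI / 2 * IZR z) ^ 2)
      Hlam Heta Hr Hp Hq Hb Hcb H1 Hseq_incr Hseq_lim Ha_incr Ha_seq Hinv_r HI1 HI2).
    apply filterlim_ext; intro n; apply sum_n_ext; intro j; rewrite <- INR_IZR_INZ; reflexivity.
Qed.
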